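(* Let $\mathcal{E}_n$ be the set of Eulerian tournaments on vertex set $[2n+1]$. If $D$ is chosen uniformly at random from $\mathcal{E}_n$, then $\Pr(D\text{ is oblivious})=O(n^{-2})$, i.e. there is a constant $C$ with $\Pr(D\text{ is oblivious})\le Cn^{-2}$ for all $n\ge1$.
   Context: A tournament $D$ is a digraph (finite vertex set $V(D)$, arcs are ordered pairs of distinct vertices) such that for all distinct $u,v$ exactly one of $uv,vu$ is an arc; it is Eulerian if every vertex has equal in- and out-degree. $N^+(v)=\{u:vu\in E(D)\}$, $N^-(v)=\{u:uv\in E(D)\}$. A restriction vector is a vector $\mathbf{r}$ of nonnegative integers indexed by $V(D)$; $\operatorname{supp}(\mathbf{r})=\{v:\mathbf{r}_v>0\}$; $\delta_v$ is the indicator vector of $v$. Semi-restricted $D$-game with parameter $\mathbf{r}$: Rei and Norman play $\sum_u\mathbf{r}_u$ rounds; in each round both simultaneously choose a vertex, Rei being required to choose each $u$ exactly $\mathbf{r}_u$ times overall, Norman unrestricted. A strategy for Norman is a function $\mathcal{N}$ assigning to each restriction vector a random variable with values in $V(D)$; a strategy for Rei is a function $\mathcal{R}$ assigning to each $\mathbf{r}$ a random variable with values in $\operatorname{supp}(\mathbf{r})$ (choices independent across players and rounds). Norman's score is defined recursively: $0$ if $\mathbf{r}=0$; otherwise with $x=\mathcal{N}(\mathbf{r})$, $y=\mathcal{R}(\mathbf{r})$, Norman gains $+1$ if $y\in N^+(x)$, $-1$ if $y\in N^-(x)$, $0$ otherwise, and play continues from $\mathbf{r}-\delta_y$. $S_D(\mathbf{r};\mathcal{N},\mathcal{R})$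 is the expected score, $S_D(\mathbf{r};\mathcal{R})=\max_{\mathcal{N}}S_D(\mathbf{r};\mathcal{N},\mathcal{R})$, $S_D(\mathbf{r})=\min_{\mathcal{R}}S_D(\mathbf{r};\mathcal{R})$; $\mathcal{R}$ is optimal if $S_D(\mathbf{r};\mathcal{R})=S_D(\mathbf{r})$ for all $\mathbf{r}$. A strategy $\mathcal{R}$ for Rei is oblivious if the distribution of $\mathcal{R}(\mathbf{r})$ depends only on $\operatorname{supp}(\mathbf{r})$; $D$ is oblivious if Rei has an optimal strategy that is oblivious. *)

(* Defs.v *)
From mathcomp Require Import all_boot all_order all_algebra.
From mathcomp Require Import boolp classical_sets reals.
From mathcomp Require Import zify.

Set Implicit Arguments.
Unset Strict Implicit.
Unset Printing Implicit Defensive.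

Import Order.TTheory GRing.Theory Num.Theory.
Local Open Scope ring_scope.

(** A digraph on [V] is given by its set of arcs, of type [{set V * V}]. *)
Section Digraphs.
Variable V : finType.
Implicit Types (D : {set V * V}) (u v : V).

Definition out_nbrs D v : {set V} := [set u | (v, u) \in D]%SET.
Definition in_nbrs D v : {set V} := [set u | (u, v) \in D]%SET.

(** The first conjunct excludes loops: arcs join distinct vertices. *)
Definition tournament D : bool :=
  [forall v, (v, v) \notin D] &&
  [forall u, forall v, (u != v) ==> (((u, v) \in D) (+) ((v, u) \in D))].

Definition eulerian D : bool := [forall v, #|out_nbrs D v| == #|in_nbrs D v|].

End Digraphs.

Definition restriction (V : finType) := {ffun V -> nat}.

Section Game.
Variables (R : realType) (V : finType).
Implicit Types (D : {set V * V}) (r : restriction V) (x y v : V).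

Definition supp r : {set V} := [set v | (0 < r v)%N]%SET.

(** [dec r y] is r - delta_y; the truncation at 0 is only reached for y outside
    the support of r, where Rei's choice has probability 0. *)
Definition dec r y : restriction V := [ffun v => r v - (v == y)]%N.

Definition rounds r : nat := (\sum_v r v)%N.

(** Choices are independent across players and rounds, so that a random choice
    of a vertex is represented by its probability mass function. *)
Definition distribution (p : V -> R) : Prop :=
  (forall v, 0 <= p v) /\ \sum_v p v = 1.

Definition strategy := restriction V -> V -> R.

Definition norman_strategy (N : strategy) : Prop :=
  forall r, distribution (N r).

(** Nothing is required at r = 0, where the support is empty and the game is
    over. *)
Definition rei_strategy (S : strategy) : Prop :=
  forall r, (exists v, v \in supp r) ->
    distribution (S r) /\ (forall v, v \notin supp r -> S r v = 0).

Definition gain D x y : R :=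
  if y \in out_nbrs D x then 1 else if y \in in_nbrs D x then -1 else 0.

Fixpoint score_in D (N S : strategy) (k : nat) r : R :=
  if k is k'.+1 then
    \sum_x \sum_y N r x * S r y * (gain D x y + score_in D N S k' (dec r y))
  else 0.

Definition score D (N S : strategy) r : R := score_in D N S (rounds r) r.

(** [score0] and [scoreE] are the defining recursion of the expected score; the
    number of rounds in [score_in] only serves to make it structural. *)
Lemma score0 D N S r : (forall v, r v = 0%N) -> score D N S r = 0.
Proof. by move=> r0; rewrite /score /rounds big1. Qed.

Lemma rounds_dec r y : y \in supp r -> rounds r = (rounds (dec r y)).+1.
Proof.
rewrite inE => ry; rewrite /rounds (bigD1 y) //= [in RHS](bigD1 y) //=.
rewrite ffunE eqxx -addSn subn1 prednK //; congr addn.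
by apply: eq_bigr => v /negPf vy; rewrite ffunE vy subn0.
Qed.

Lemma scoreE D N S r : rei_strategy S -> (exists v, v \in supp r) ->
  score D N S r =
  \sum_x \sum_(y in supp r)
    N r x * S r y * (gain D x y + score D N S (dec r y)).
Proof.
move=> hS hr; have [v hv] := hr; have [_ S0] := hS r hr.
rewrite /score (rounds_dec hv) /=; apply: eq_bigr => x _.
rewrite [RHS]big_mkcond /=; apply: eq_bigr => y _.
case: ifPn => hy; last by rewrite S0 // mulr0 mul0r.
by have := rounds_dec hy; rewrite (rounds_dec hv) => -[->].
Qed.

(** The maximum and the minimum in the definition of the value are rendered by
    [sup] and [inf]. Both are attained: Norman's choice does not affect the
    continuation of the game, so that some pure strategy is a best response; the
    minimum exists by compactness of the simplex of laws on supp(r). *)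
Definition rei_score D (S : strategy) r : R :=
  sup [set s | exists2 N, norman_strategy N & s = score D N S r]%classic.

Definition game_value D r : R :=
  inf [set s | exists2 S, rei_strategy S & s = rei_score D S r]%classic.

Definition optimal D (S : strategy) : Prop :=
  rei_strategy S /\ forall r, rei_score D S r = game_value D r.

Definition oblivious_strategy (S : strategy) : Prop :=
  forall r r', supp r = supp r' -> S r =1 S r'.

Definition oblivious D : Prop :=
  exists S, optimal D S /\ oblivious_strategy S.

End Game.

(** The vertex set [2n+1] is represented by {0, ..., 2n}. *)
Definition eulerian_tournaments (n : nat) :
    {set {set 'I_(2 * n).+1 * 'I_(2 * n).+1}} :=
  [set D | tournament D && eulerian D]%SET.

(** The uniform distribution below is well defined: the rotational tournament is
    Eulerian. *)
Lemma eulerian_tournaments_gt0 (n : nat) : (0 < #|eulerian_tournaments n|)%N.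
Proof.
pose A := [set d : 'I_(2 * n).+1 | (0 < d <= n)%N]%SET.
pose D := [set p : 'I_(2 * n).+1 * 'I_(2 * n).+1 | (p.2 - p.1)%R \in A]%SET.
have DE u v : ((u, v) \in D) = ((v - u)%R \in A) by rewrite [LHS]inE.
apply/card_gt0P; exists D; rewrite inE; apply/andP; split.
  apply/andP; split.
    by apply/forallP => v; rewrite DE subrr inE.
  apply/forallP => u; apply/forallP => v; apply/implyP => uv.
  have : v - u != 0 by rewrite subr_eq0 eq_sym.
  rewrite !DE -(opprB v u).
  move: (v - u) => d d0; rewrite !inE /=.
  have dgt0 : (0 < d)%N by rewrite lt0n; apply: contra d0 => /eqP ?; apply/eqP/val_inj.
  have dlt := ltn_ord d.
  rewrite modn_small; last by rewrite ltn_subrL dgt0.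
  rewrite subn_gt0 dlt dgt0 /= leq_subLR.
  by case: leqP => h; apply/idP; rewrite -?ltnNge; lia.
have out v : #|out_nbrs D v| = #|A|.
  rewrite -[RHS](card_imset _ (addrI v)); apply: eq_card => u; rewrite [LHS]finset.in_set DE.
  apply/idP/imsetP => [h|[d hd ->]]; last by rewrite addrC addKr.
  by exists (u - v) => //; rewrite addrC subrK.
have inn v : #|in_nbrs D v| = #|A|.
  rewrite -[RHS](card_imset _ (@subrI _ v)); apply: eq_card => u; rewrite [LHS]finset.in_set DE.
  apply/idP/imsetP => [h|[d hd ->]]; last by rewrite subKr.
  by exists (v - u) => //; rewrite subKr.
by apply/forallP => v; rewrite out inn.
Qed.

Definition prob_oblivious (R : realType) (n : nat) : R :=
  #|[set D in eulerian_tournaments n | `[< oblivious R D >]]%SET|%:R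
  / #|eulerian_tournaments n|%:R.

(* Main.v *)
Require Import Defs.
From mathcomp Require Import all_boot all_order all_algebra.
From mathcomp Require Import boolp classical_sets reals.
From mathcomp Require Import fintype finset zify ring lra.

Import Order.TTheory GRing.Theory Num.Theory.
Local Open Scope ring_scope.

Set Implicit Arguments.
Unset Strict Implicit.
Unset Printing Implicit Defensive.

(** Let A be the skew-symmetric payoff matrix of D. If Rei starts from k copies of
    a vector r, moving in the direction of r costs k max_x (A r)_x + O(sqrt k).
    If S is oblivious and x maximises (A r)_x, Norman can play x throughout,
    except that as long as the support is still supp(r) he plays a best response
    to the fixed distribution p = S(r): this earns k (A r)_x plus a multiple of
    k (max_z (A p)_z - (A p)_x). Hence optimality forces every x that is a best
    response to some r with the given support T to be a best response to p.

    Take D Eulerian and T = V - v. If no two distinct out-neighbourhoods satisfy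
    |N^+(x) \ N^+(y)| = 1, then every x is a best response to some r with support
    T, so that A p is constant, hence A p = 0; as the kernel of A meets the
    vectors vanishing at v trivially (parity of a determinant), p = 0, which is
    absurd.

    Finally, for fixed x <> y, reversing cyclic triangles x -> c -> j -> x with c a
    common out-neighbour and j a common in-neighbour increases
    |N^+(x) \ N^+(y)| by one; there are of order n^2 such reversals and boundedly
    many inverse ones. Two such steps show that |N^+(x) \ N^+(y)| = 1 has
    probability O(n^-4), and there are O(n^2) pairs (x, y). *)

(** * Payoffs and expected scores *)

Section Game.
Variables (R : realType) (V : finType) (D : {set V * V}).
Implicit Types (r : restriction V) (x y z : V) (N S : strategy R V) (p : V -> R).

Definition payoff p x : R := \sum_y p y * gain R D x y.

Definition weight r : V -> R := fun y => (r y)%:R.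

Lemma gain_ge x y : -1 <= gain R D x y.
Proof. by rewrite /gain; case: ifP => _; [|case: ifP => _]; lra. Qed.

Lemma gain_le x y : gain R D x y <= 1.
Proof. by rewrite /gain; case: ifP => _; [|case: ifP => _]; lra. Qed.

Lemma rounds_eq0 r : supp r = set0 -> rounds r = 0%N.
Proof.
move=> r0; apply: big1 => v _; apply/eqP; rewrite -leqn0 leqNgt.
by have := in_set0 v; rewrite -r0 inE => ->.
Qed.

Lemma weight_rounds r : \sum_y weight r y = (rounds r)%:R.
Proof. by rewrite /rounds natr_sum. Qed.

Lemma weight_dec r y u : y \in supp r -> weight (dec r y) u = weight r u - (u == y)%:R.
Proof.
rewrite inE /weight ffunE; case: eqVneq => [->|_] ry; last by rewrite subn0 subr0.
by rewrite natrB.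
Qed.

Lemma payoff_dec r x y : y \in supp r ->
  payoff (weight (dec r y)) x = payoff (weight r) x - gain R D x y.
Proof.
move=> ry; rewrite /payoff.
under eq_bigr do rewrite weight_dec // mulrBl.
rewrite big_split /= sumrN; congr (_ - _).
rewrite (bigD1 y) //= eqxx mul1r big1 ?addr0 // => u /negPf ->.
by rewrite mul0r.
Qed.

Lemma score_eq0 N S r : supp r = set0 -> score D N S r = 0.
Proof. by move=> r0; rewrite /score rounds_eq0. Qed.

Lemma distribution_supp S r : rei_strategy S -> (exists v, v \in supp r) ->
  \sum_(y in supp r) S r y = 1.
Proof.
move=> hS hr; have [[_ <-] S0] := hS r hr.
by rewrite [RHS](bigID (mem (supp r))) /= [X in _ = _ + X]big1 ?addr0.
Qed.

(** Norman's choice does not influence the next position, so his law sums out of the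
    continuation. *)
Lemma score_step N S r : rei_strategy S -> norman_strategy N ->
  (exists v, v \in supp r) ->
  score D N S r = \sum_x N r x * payoff (S r) x +
                  \sum_(y in supp r) S r y * score D N S (dec r y).
Proof.
move=> hS hN hr; rewrite scoreE //.
have [_ S0] := hS r hr; have [_ N1] := hN r.
under eq_bigr => x _ do under eq_bigr => y _ do rewrite mulrDr.
under eq_bigr => x _ do rewrite big_split /=.
rewrite big_split /=; congr (_ + _).
  apply: eq_bigr => x _; rewrite /payoff mulr_sumr [RHS](bigID (mem (supp r))) /=.
  rewrite [X in _ = _ + X]big1 ?addr0 => [|y /S0 ->]; last by rewrite mul0r mulr0.
  by apply: eq_bigr => y _; rewrite mulrA.
rewrite exchange_big /=; apply: eq_bigr => y _.
under eq_bigr => x _ do rewrite -mulrA.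
by rewrite -mulr_suml N1 mul1r.
Qed.

Lemma rounds_ind (P : restriction V -> Prop) :
  (forall r, supp r = set0 -> P r) ->
  (forall r, (exists v, v \in supp r) -> (forall y, y \in supp r -> P (dec r y)) -> P r) ->
  forall r, P r.
Proof.
move=> P0 PS r; elim: {r}(rounds r) {-2}r (erefl (rounds r)) => [|k IH] r rk.
  apply: P0; apply/setP => v; rewrite !inE; apply/negP => v0.
  by have := @rounds_dec _ r v; rewrite inE rk => /(_ v0).
have [r0|[v rv]] := set_0Vmem (supp r); first exact: P0.
apply: PS => [|y ry]; first by exists v.
by apply: IH; move: (rounds_dec ry); rewrite rk => -[].
Qed.

Lemma payoff_bound p x : distribution p -> -1 <= payoff p x <= 1.
Proof.
move=> [p0 p1]; rewrite /payoff; apply/andP; split.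
  rewrite -p1 -sumrN; apply: ler_sum => y _.
  by have := p0 y; have := gain_ge x y; nra.
rewrite -p1; apply: ler_sum => y _.
by have := p0 y; have := gain_le x y; nra.
Qed.

(** Keeps the sets behind [sup] and [inf] bounded, and controls the end of the game once a vertex is
    exhausted. *)
Lemma score_bound N S r : rei_strategy S -> norman_strategy N ->
  - (rounds r)%:R <= score D N S r <= (rounds r)%:R.
Proof.
move=> hS hN; elim/rounds_ind: r => [r r0|r hr IH].
  by rewrite score_eq0 // rounds_eq0 // oppr0 lexx.
have [v rv] := hr; have [hSr _] := hS r hr; have [N0 N1] := hN r.
rewrite score_step //.
have S1 := distribution_supp hS hr.
have E y : y \in supp r -> (rounds r)%:R = 1 + (rounds (dec r y))%:R :> R.
  by move=> ry; rewrite (rounds_dec ry) -natr1 addrC.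
have [S0 _] := hSr.
have E1 : (rounds r)%:R = \sum_x N r x * 1 + \sum_(y in supp r) S r y * (rounds (dec r y))%:R.
  rewrite -mulr_suml N1 mul1r -[X in X + _]S1 -big_split /= -[LHS]mul1r -[X in X * _]S1 mulr_suml.
  by apply: eq_bigr => y ry; rewrite (E y ry); ring.
apply/andP; split.
  rewrite E1 opprD -!sumrN; apply: lerD; apply: ler_sum => y ry.
    by have := N0 y; have /andP[] := payoff_bound y hSr; nra.
  by have := S0 y; have /andP[] := IH y ry; nra.
rewrite E1; apply: lerD; apply: ler_sum => y ry.
  by have := N0 y; have /andP[] := payoff_bound y hSr; nra.
by have := S0 y; have /andP[] := IH y ry; nra.
Qed.

Definition pure x : V -> R := fun y => (y == x)%:R.

Lemma pure_distribution x : distribution (pure x).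
Proof.
split=> [v|]; first exact: ler0n.
by rewrite /pure (bigD1 x) //= eqxx big1 ?addr0 // => y /negPf ->.
Qed.

Lemma sum_pure x (F : V -> R) : \sum_y pure x y * F y = F x.
Proof.
rewrite (bigD1 x) //= /pure eqxx mul1r big1 ?addr0 // => y /negPf ->.
by rewrite mul0r.
Qed.

Lemma score_le_rei_score N S r : rei_strategy S -> norman_strategy N ->
  score D N S r <= rei_score D S r.
Proof.
move=> hS hN; apply: ub_le_sup; last by exists N.
by exists (rounds r)%:R => _ [N' hN' ->]; have /andP[] := score_bound r hS hN'.
Qed.

(** The vertex [v] provides a pure strategy, so that the set under [sup] is nonempty. *)
Lemma rei_score_le (v : V) S r B :
  (forall N, norman_strategy N -> score D N S r <= B) -> rei_score D S r <= B.
Proof.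
move=> h; apply: ge_sup.
  exists (score D (fun _ => pure v) S r), (fun _ => pure v) => // r'.
  exact: pure_distribution.
by move=> _ [N hN ->]; exact: h.
Qed.

Lemma game_value_le (v : V) S r : rei_strategy S -> game_value R D r <= rei_score D S r.
Proof.
move=> hS; apply: ge_inf; last by exists S.
exists (- (rounds r)%:R) => _ [S' hS' ->].
have hN : norman_strategy (fun _ => pure v) by move=> r'; exact: pure_distribution.
apply: le_trans (score_le_rei_score r hS' hN).
by have /andP[] := score_bound r hS' hN.
Qed.

Lemma sum_supp S r (F : V -> R) : rei_strategy S -> (exists v, v \in supp r) ->
  \sum_(y in supp r) S r y * F y = \sum_y S r y * F y.
Proof.
move=> hS hr; have [_ S0] := hS r hr.
rewrite [RHS](bigID (mem (supp r))) /= [X in _ = _ + X]big1 ?addr0 // => y /S0 ->.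
by rewrite mul0r.
Qed.

(** [payoff (weight r) x] is a potential: a round lowers it on average by exactly what [x] earns in
    that round. *)
Lemma sum_payoff_dec S r x : rei_strategy S -> (exists v, v \in supp r) ->
  \sum_(y in supp r) S r y * payoff (weight (dec r y)) x =
  payoff (weight r) x - payoff (S r) x.
Proof.
move=> hS hr.
under eq_bigr => y ry do rewrite payoff_dec // mulrBr.
rewrite big_split /= -mulr_suml distribution_supp // mul1r; congr (_ + _).
by rewrite sumrN sum_supp.
Qed.

(* Always playing [x] earns exactly [payoff (weight r) x] against any strategy;
   playing [z] as long as the support is [T] improves each of these rounds, of
   which there are at least [j]. *)
Lemma score_lower S (T : {set V}) p x z j r :
  rei_strategy S -> (forall r', supp r' = T -> S r' =1 p) ->
  T != set0 -> payoff p x <= payoff p z ->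
  supp r \subset T -> (forall v, v \in T -> (j <= r v)%N) ->
  payoff (weight r) x + j%:R * (payoff p z - payoff p x) <=
  score D (fun r' => if supp r' == T then pure z else pure x) S r.
Proof.
set N := fun r' => _; move=> hS hp Tn0 xz.
have hN : norman_strategy N by move=> r'; rewrite /N; case: ifP => _; exact: pure_distribution.
elim/rounds_ind: r j => [r r0|r hr IH] j rT rj.
  rewrite score_eq0 //; have -> : j = 0%N.
    have [v vT] := set0Pn _ Tn0; apply/eqP; rewrite -leqn0 (leq_trans (rj v vT)) //.
    by rewrite leqNgt; have := in_set0 v; rewrite -r0 inE => ->.
  rewrite mul0r addr0 /payoff big1 // => v _.
  have : v \notin supp r by rewrite r0 inE.
  by rewrite inE -eqn0Ngt /weight => /eqP ->; rewrite mul0r.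
have decT y : supp (dec r y) \subset T.
  apply: subset_trans rT; apply/subsetP => v; rewrite !inE ffunE.
  by move=> h; apply: leq_trans h _; exact: leq_subr.
rewrite score_step // /N; case: eqP => [rTe|rTn].
  have pay u : payoff (S r) u = payoff p u by apply: eq_bigr => y _; rewrite hp.
  rewrite sum_pure pay.
  have le1 y : y \in supp r -> S r y * (payoff (weight (dec r y)) x + j%:R * (payoff p z - payoff p x) - (payoff p z - payoff p x))
      <= S r y * score D N S (dec r y).
    move=> ry; apply: ler_wpM2l; first by have [[]] := hS r hr.
    (* For [j = 0] the surplus of this round is given up, as [payoff p x <= payoff p z] allows;
       otherwise it supplies one of the claimed surpluses. *)
    case: j rj => [|j] rj.
      rewrite mul0r addr0; have := IH y ry 0%N (decT y) (fun _ _ => leq0n _).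
      by rewrite mul0r addr0; lra.
    have := IH y ry j (decT y) _; rewrite -natr1.
    have h v : v \in T -> (j <= dec r y v)%N.
      by move=> vT; rewrite ffunE; have := rj v vT; case: (v == y); lia.
    by move=> /(_ h); lra.
  apply: (le_trans _ (lerD (lexx _) (ler_sum _ le1))).
  under eq_bigr => y ry do rewrite -addrA mulrDr.
  rewrite big_split /= sum_payoff_dec // pay -mulr_suml distribution_supp //.
  lra.
(* Once a vertex of [T] is exhausted, no further surplus is claimed. *)
have j0 : j = 0%N.
  have : ~~ (T \subset supp r) by apply/negP => h; apply: rTn; apply/eqP; rewrite eqEsubset rT.
  case/subsetPn => v vT; rewrite inE -leqNgt => rv0.
  by apply/eqP; rewrite -leqn0 (leq_trans (rj v vT)).
rewrite j0 mul0r addr0 sum_pure.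
rewrite -[leLHS](subrKC (payoff (S r) x)) lerD2l -sum_payoff_dec //.
apply: ler_sum => y ry; apply: ler_wpM2l; first by have [[]] := hS r hr.
by have := IH y ry 0%N (decT y) (fun _ _ => leq0n _); rewrite mul0r addr0.
Qed.


(** * Following a fixed direction, and best responses to an oblivious strategy *)

Definition deviation (q : V -> R) r : R := \sum_y (weight r y - q y * (rounds r)%:R) ^+ 2.

(** A move drawn from [q] changes [weight r u - q u * rounds r] by a term of mean 0, so the cross
    terms cancel; the variances [q u * (1 - q u)] sum to at most 1. *)
Lemma deviation_step q r : distribution q -> (exists v, v \in supp r) ->
  (forall v, v \notin supp r -> q v = 0) ->
  \sum_y q y * deviation q (dec r y) <= deviation q r + 1.
Proof.
move=> [q0 q1] [v0 rv0] qs.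
have E y : q y * deviation q (dec r y) =
  q y * \sum_u ((weight r u - q u * (rounds r)%:R) - ((u == y)%:R - q u)) ^+ 2.
  have [ry|/qs ->] := boolP (y \in supp r); last by rewrite !mul0r.
  congr (_ * _); apply: eq_bigr => u _; congr (_ ^+ 2).
  by rewrite weight_dec // [in RHS](rounds_dec ry) -natr1; ring.
under eq_bigr do rewrite E mulr_sumr.
rewrite exchange_big /=.
have : \sum_u ((weight r u - q u * (rounds r)%:R) ^+ 2 + q u) = deviation q r + 1.
  by rewrite big_split /= q1.
move=> <-; apply: ler_sum => u _.
set d := weight r u - _.
have -> : \sum_y q y * (d - ((u == y)%:R - q u)) ^+ 2 =
    \sum_y (q y * (d + q u) ^+ 2 + pure u y * (q y * (1 - 2 * (d + q u)))).
  apply: eq_bigr => y _; rewrite /pure eq_sym.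
  by case: (y == u) => /=; ring.
rewrite big_split /= sum_pure -mulr_suml q1.
have := q0 u; nra.
Qed.

Lemma deviation_ge0 q r : 0 <= deviation q r.
Proof. by apply: sumr_ge0 => y _; exact: sqr_ge0. Qed.

Lemma deviation_depleted q r y : r y = 0%N ->
  (q y * (rounds r)%:R) ^+ 2 <= deviation q r.
Proof.
move=> ry; rewrite /deviation (bigD1 y) //= {1}/weight ry sub0r sqrrN lerDl.
by apply: sumr_ge0 => u _; exact: sqr_ge0.
Qed.

(* The direction of [r0] is followed until one of its coordinates is exhausted;
   as in Chebyshev's inequality, the variance bounds the number of the remaining
   rounds. *)
Lemma score_upper r0 x M : (exists v, v \in supp r0) ->
  (forall y, payoff (weight r0) y <= payoff (weight r0) x) -> (0 < M)%N ->
  exists2 S, rei_strategy S & forall N, norman_strategy N ->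
    score D N S [ffun v => M ^ 2 * r0 v]%N <=
    (M ^ 2)%:R * payoff (weight r0) x + 2 * M%:R * (1 + (rounds r0)%:R ^+ 3).
Proof.
move=> [v0 rv0] xmax M0; set T := supp r0; set L : R := (rounds r0)%:R.
have L0 : 0 < L by rewrite ltr0n (rounds_dec rv0).
pose q y := weight r0 y / L.
have hq : distribution q.
  split=> [v|]; first by rewrite divr_ge0 // ler0n.
  by rewrite -mulr_suml weight_rounds divff // gt_eqF.
have qT v : v \notin T -> q v = 0.
  by rewrite inE -eqn0Ngt /q /weight => /eqP ->; rewrite mul0r.
have payq y : payoff q y = payoff (weight r0) y / L.
  by rewrite /payoff mulr_suml; apply: eq_bigr => u _; rewrite /q mulrAC.
(* Off the full support any legal move will do: those rounds are bounded trivially. *)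
pose S : strategy R V := fun r => if supp r == T then q else
  if [pick v in supp r] is Some v then pure v else q.
have hS : rei_strategy S.
  move=> r [v rv]; rewrite /S; case: eqP => [rT|_]; first by split=> // u; rewrite rT; exact: qT.
  case: pickP => [w rw|]; last by move/(_ v); rewrite rv.
  split=> [|u ru]; first exact: pure_distribution.
  by rewrite /pure; case: eqP => // uw; rewrite uw rw in ru.
exists S => // N hN; set f := payoff q x.
have f_ge : -1 <= f by have /andP[] := payoff_bound x hq.
set m : R := M%:R; have m0 : 0 < m by rewrite ltr0n.
(* While [q] is played, deviation plus remaining rounds does not increase on average. The factor 2
   comes from [f >= -1]: [t] leftover rounds cost at most [t], against a budget of [f * t].
   Initially the deviation is 0 and [m ^ 2 * L] rounds remain, so the error term is linear in
   [m]. *)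
pose B r : R := f * (rounds r)%:R + 2 * (m + (deviation q r + (rounds r)%:R) * L ^+ 2 / m).
suff main r : supp r \subset T -> score D N S r <= B r.
  set r1 := finfun _; have r1T : supp r1 = T by apply/setP => v; rewrite !inE ffunE; nia.
  have r1L : (rounds r1)%:R = m ^+ 2 * L.
    rewrite -natrX -natrM /rounds big_distrr /=; congr (_ %:R).
    by apply: eq_bigr => v _; rewrite ffunE.
  apply: (le_trans (main r1 _)); first by rewrite r1T.
  have d0 : deviation q r1 = 0.
    rewrite /deviation big1 // => y _; rewrite r1L /q /weight ffunE natrM natrX.
    by apply/eqP; rewrite sqrf_eq0 subr_eq0; apply/eqP; field; rewrite gt_eqF.
  rewrite /B d0 r1L /f payq natrX.
  rewrite le_eqVlt; apply/orP; left; apply/eqP; field.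
  by rewrite !gt_eqF.
elim/rounds_ind: r => [r r0'|r hr IH] rT.
  rewrite score_eq0 // /B (rounds_eq0 r0') mulr0 add0r addr0 mulr_ge0 // addr_ge0 ?(ltW m0) //.
  by rewrite divr_ge0 ?mulr_ge0 ?deviation_ge0 ?sqr_ge0 ?ltW.
have [rTe|rTn] := eqVneq (supp r) T; last first.
  have /andP[_ h] := score_bound r hS hN; apply: le_trans h _.
  have : ~~ (T \subset supp r) by apply: contra rTn => h; rewrite eqEsubset rT.
  case/subsetPn => y yT; rewrite inE -eqn0Ngt => /eqP ry.
  have := deviation_depleted q ry; rewrite /B.
  move: (deviation q r) ((rounds r)%:R : R) (ler0n R (rounds r)) => d t t0 hd.
  (* The positive entries of [r0] are integers, hence at least 1. *)
  have hq1 : L^-1 <= q y.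
    by rewrite /q /weight ler_peMl ?invr_ge0 ?(ltW L0) // ler1n; move: yT; rewrite inE.
  have h1 : t ^+ 2 <= d * L ^+ 2.
    have : (L^-1 * t) ^+ 2 <= d.
      apply: le_trans hd; rewrite ler_sqr ?nnegrE ?mulr_ge0 ?invr_ge0 ?(ltW L0) //.
      exact: ler_wpM2r.
    by rewrite exprMn exprVn mulrC ler_pdivrMr ?exprn_gt0.
  (* This linearises the square root of [h1], through [t * m <= m ^ 2 + t ^ 2]. *)
  have h2 : t <= m + (d + t) * L ^+ 2 / m.
    have : t * m <= m ^+ 2 + (d + t) * L ^+ 2.
      have : 0 <= t * L ^+ 2 by rewrite mulr_ge0 ?sqr_ge0.
      by nra.
    by move=> h; rewrite -(ler_pM2r m0) mulrDl divfK ?gt_eqF // -expr2.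
  by nra.
have Sr : S r = q by rewrite /S rTe eqxx.
rewrite score_step //.
have le1 : \sum_x0 N r x0 * payoff (S r) x0 <= f.
  have [N0 N1] := hN r.
  rewrite -[leRHS]mul1r -N1 mulr_suml; apply: ler_sum => y _.
  by apply: ler_wpM2l => //; rewrite Sr /f !payq ler_pM2r ?invr_gt0.
have le2 : \sum_(y in supp r) S r y * score D N S (dec r y) <=
           \sum_(y in supp r) S r y * B (dec r y).
  apply: ler_sum => y ry; apply: ler_wpM2l; first by rewrite Sr; case: hq.
  apply: IH => //; apply: subset_trans rT; apply/subsetP => v; rewrite !inE ffunE.
  by move=> h; apply: leq_trans h _; exact: leq_subr.
apply: (le_trans (lerD le1 le2)).
have dstep := deviation_step hq hr; rewrite rTe in dstep.
have : \sum_(y in supp r) S r y * B (dec r y) =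
   f * ((rounds r)%:R - 1) + 2 * (m + (\sum_y q y * deviation q (dec r y) + ((rounds r)%:R - 1)) * L ^+ 2 / m).
  transitivity (\sum_(y in supp r) S r y * (f * ((rounds r)%:R - 1) + 2 * (m + ((rounds r)%:R - 1) * L ^+ 2 / m) + deviation q (dec r y) * (2 * L ^+ 2 / m))).
    apply: eq_bigr => y ry; rewrite /B; congr (_ * _).
    by rewrite (rounds_dec ry) -natr1; field; rewrite gt_eqF.
  under eq_bigr do rewrite mulrDr.
  rewrite big_split /= -mulr_suml distribution_supp // mul1r.
  under [X in _ + X]eq_bigr do rewrite mulrA.
  rewrite -mulr_suml sum_supp // Sr.
  by field; rewrite gt_eqF.
move=> ->; rewrite /B.
have := dstep (fun v => @qT v).
move: (\sum_y _) (deviation q r) => a d ad.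
have : 0 <= (d + 1 - a) * (L ^+ 2 / m).
  by rewrite mulr_ge0 ?subr_ge0 ?divr_ge0 ?sqr_ge0 ?(ltW m0).
lra.
Qed.

Lemma optimal_oblivious_argmax S r0 x z : optimal D S -> oblivious_strategy S ->
  (exists v, v \in supp r0) ->
  (forall y, payoff (weight r0) y <= payoff (weight r0) x) ->
  payoff (S r0) z <= payoff (S r0) x.
Proof.
move=> [hS Sopt] Sobl hr0 xmax; rewrite leNgt; apply/negP => lt_xz.
set g := payoff (S r0) z - payoff (S r0) x.
have g0 : 0 < g by rewrite subr_gt0.
set c := 1 + (rounds r0)%:R ^+ 3 : R.
(* With [M ^ 2] copies of [r0] Norman's surplus is [M ^ 2 * g], while Rei's loss is linear in [M];
   one factor [M] cancels. *)
have key M : (0 < M)%N -> M%:R * g <= 2 * c.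
  move=> M0; have [S' hS' S'le] := score_upper hr0 xmax M0.
  pose r := [ffun v => M ^ 2 * r0 v]%N.
  have rT : supp r = supp r0 by apply/setP => v; rewrite !inE ffunE; nia.
  pose N : strategy R V := fun r' => if supp r' == supp r0 then pure z else pure x.
  have hN : norman_strategy N by move=> r'; rewrite /N; case: ifP => _; exact: pure_distribution.
  have T0 : supp r0 != set0 by have [v rv] := hr0; apply/set0Pn; exists v.
  have low : payoff (weight r) x + (M ^ 2)%:R * g <= score D N S r.
    apply: score_lower => //; first by move=> r' r'T; exact: Sobl.
    - exact: ltW.
    - by rewrite rT.
    - by move=> v; rewrite inE ffunE => ?; nia.
  have := score_le_rei_score r hS hN; rewrite Sopt => h1.
  have := game_value_le x r hS' => h2.
  have := rei_score_le x S'le; rewrite -/r => h3.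
  have := le_trans low (le_trans h1 (le_trans h2 h3)).
  have -> : payoff (weight r) x = (M ^ 2)%:R * payoff (weight r0) x.
    rewrite /payoff mulr_sumr; apply: eq_bigr => y _.
    by rewrite /weight ffunE natrM mulrA.
  rewrite lerD2l -/c natrX => h.
  have Mp : 0 < M%:R :> R by rewrite ltr0n.
  by rewrite -(ler_pM2l Mp); move: h; lra.
have [M hM] : exists M : nat, 2 * c / g < M%:R.
  by exists (Num.bound (2 * c / g)); apply: archi_boundP; rewrite divr_ge0 ?(ltW g0) // mulr_ge0 // addr_ge0 // exprn_ge0.
have M0 : (0 < M)%N.
  rewrite -(ltr0n R); apply: le_lt_trans hM.
  by rewrite divr_ge0 ?(ltW g0) // mulr_ge0 // addr_ge0 // exprn_ge0.
by have := key M M0; rewrite leNgt -ltr_pdivrMr // hM.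
Qed.

End Game.

(** * Reversing cyclic triangles in Eulerian tournaments *)

Section Switching.
Local Open Scope nat_scope.
Variables (V : finType).
Implicit Types (D : {set V * V}) (x y u v c j : V).

Lemma tournament_irr D v : tournament D -> (v, v) \notin D.
Proof. by case/andP => /forallP. Qed.

Lemma tournamentN D u v : tournament D -> u != v -> ((u, v) \in D) = ((v, u) \notin D).
Proof.
case/andP => _ /forallP /(_ u) /forallP /(_ v) /implyP h /h.
by case: (_ \in D) (_ \in D) => -[].
Qed.

Lemma tournament_asym D u v : tournament D -> (u, v) \in D -> (v, u) \notin D.
Proof.
move=> tD uv; have [uve|nuv] := eqVneq u v; last by rewrite -tournamentN.
by rewrite uve (negPf (tournament_irr v tD)) in uv.
Qed.

Lemma card_out_in D v : tournament D -> #|out_nbrs D v| + #|in_nbrs D v| = #|V|.-1.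
Proof.
move=> tD; rewrite -(cardsC1 v) -cardsUI [X in _ + X](_ : _ = 0) ?addn0.
  apply: eq_card => u; rewrite !inE; have [->|uv] := eqVneq u v.
    by rewrite (negPf (tournament_irr v tD)).
  by rewrite (tournamentN tD uv) orbN.
apply/eqP; rewrite cards_eq0; apply/eqP/setP => u; rewrite !inE.
by apply/negP => /andP[vu uv]; have := tournament_asym tD vu; rewrite uv.
Qed.

Lemma eulerian_out n D : #|V| = (2 * n).+1 -> tournament D ->
  eulerian D = [forall v, #|out_nbrs D v| == n].
Proof.
move=> Vn tD; apply: eq_forallb => v; have := card_out_in v tD; rewrite Vn /=; lia.
Qed.

(* On a triangle of a tournament, this reverses the three arcs. *)
Definition toggle (A : {set V}) D : {set V * V} :=
  [set e | (e \in D) (+) [&& e.1 \in A, e.2 \in A & e.1 != e.2]].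

Lemma toggleK A : involutive (toggle A).
Proof. by move=> D; apply/setP => e; rewrite !inE -addbA addbb addbF. Qed.

Lemma toggle_tournament A D : tournament D -> tournament (toggle A D).
Proof.
move=> tD; apply/andP; split.
  by apply/forallP => v; rewrite inE /= eqxx !andbF addbF tournament_irr.
apply/forallP => u; apply/forallP => v; apply/implyP => uv.
rewrite !inE /= (tournamentN tD uv) (eq_sym v u) andbCA.
by case: ((v, u) \in D); case: [&& _, _ & _].
Qed.

Lemma out_toggleN (A : {set V}) D v : v \notin A -> out_nbrs (toggle A D) v = out_nbrs D v.
Proof. by move=> vA; apply/setP => u; rewrite !inE /= (negPf vA) addbF. Qed.

Lemma out_toggle x c j D : tournament D -> (x, c) \in D -> (c, j) \in D -> (j, x) \in D ->
  out_nbrs (toggle [set x; c; j] D) x = j |: (out_nbrs D x :\ c).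
Proof.
move=> tD xc cj jx; apply/setP => u; rewrite !inE /= eqxx /=.
have neq a b : (a, b) \in D -> a != b.
  by move=> ab; apply: contraTneq ab => ->; exact: tournament_irr.
have xj : (x, j) \notin D by exact: tournament_asym.
have := (neq _ _ xc, neq _ _ cj, neq _ _ jx).
have [->|ux] := eqVneq u x.
  by rewrite (negPf (tournament_irr x tD)) [x == j]eq_sym => -[[-> _] /negPf ->].
have [->|uc] := eqVneq u c.
  by rewrite xc => -[[_ /negPf ->] _].
have [->|uj] := eqVneq u j; first by rewrite (negPf xj).
by rewrite addbF.
Qed.

Lemma card_out_toggle x c j D : tournament D -> (x, c) \in D -> (c, j) \in D -> (j, x) \in D ->
  #|out_nbrs (toggle [set x; c; j] D) x| = #|out_nbrs D x|.
Proof.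
move=> tD xc cj jx; rewrite out_toggle // cardsU1 !inE /=.
rewrite (negPf (tournament_asym tD jx)) andbF /=.
by rewrite [RHS](cardsD1 c) inE xc.
Qed.

(** Rotating the triangle transfers the degree count at [x] to [c] and [j]. *)
Lemma set3C x c j : [set x; c; j] = [set c; j; x].
Proof. by apply/setP => u; rewrite !inE -orbA orbC. Qed.

Lemma toggle_eulerian n x c j D : #|V| = (2 * n).+1 ->
  tournament D -> (x, c) \in D -> (c, j) \in D -> (j, x) \in D ->
  eulerian D -> eulerian (toggle [set x; c; j] D).
Proof.
move=> Vn tD xc cj jx; rewrite !(eulerian_out Vn) ?toggle_tournament //.
move=> /forallP eD; apply/forallP => v.
have [vA|vA] := boolP (v \in [set x; c; j]); last by rewrite out_toggleN.
move: vA; rewrite !inE => /orP[/orP[]|] /eqP ->.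
- by rewrite card_out_toggle.
- by rewrite set3C card_out_toggle.
- by rewrite 2!set3C card_out_toggle.
Qed.

Lemma sum_card (I J : finType) (A : {set I}) (F : I -> {set J}) :
  #|[set p : I * J | (p.1 \in A) && (p.2 \in F p.1)]| = \sum_(i in A) #|F i|.
Proof.
rewrite -sum1_card (eq_bigl (fun p : I * J => (p.1 \in A) && (p.2 \in F p.1))); last by move=> p; rewrite inE.
rewrite -(pair_big_dep (mem A) (fun i (k : J) => k \in F i) (fun _ _ => 1)) /=.
by apply: eq_bigr => i _; rewrite sum1_card.
Qed.

Section Codegree.
Variables (n : nat) (Vn : #|V| = (2 * n).+1).

Definition at_distance x y (d : nat) : {set {set V * V}} :=
  [set D | [&& tournament D, eulerian D & #|out_nbrs D x :\: out_nbrs D y| == d]].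

Definition common D x y := out_nbrs D x :&: out_nbrs D y.
(** In a tournament with [x != y] these are the common in-neighbours and one of [x], [y]; the latter
    is never an out-neighbour of a common out-neighbour. *)
Definition outside D x y := ~: (out_nbrs D x :|: out_nbrs D y).

Lemma card_setD_out D x y : tournament D -> eulerian D ->
  #|out_nbrs D y :\: out_nbrs D x| = #|out_nbrs D x :\: out_nbrs D y|.
Proof.
move=> tD; rewrite (eulerian_out Vn tD) => /forallP eD.
have := (cardsID (out_nbrs D x) (out_nbrs D y), cardsID (out_nbrs D y) (out_nbrs D x)).
by rewrite (eqP (eD x)) (eqP (eD y)) setIC => -[]; lia.
Qed.

Lemma card_arcs_inside D (A : {set V}) : tournament D ->
  2 * \sum_(c in A) #|out_nbrs D c :&: A| <= #|A| ^ 2.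
Proof.
move=> tD.
have E : \sum_(c in A) #|out_nbrs D c :&: A| = \sum_(c in A) \sum_(u in A) ((c, u) \in D : nat).
  apply: eq_bigr => c _; rewrite -sum1_card big_mkcond [RHS]big_mkcond /=.
  by apply: eq_bigr => u _; rewrite !inE; case: (_ \in D); case: (u \in A).
rewrite mul2n -addnn {2}E exchange_big E -big_split /=.
apply: (@leq_trans (\sum_(c in A) #|A|)); last by rewrite sum_nat_const mulnn.
apply: leq_sum => c _; rewrite -big_split /= -sum1_card; apply: leq_sum => u _.
by have := @tournament_asym D c u tD; case: ((c, u) \in D) => [/(_ isT) /negPf ->|_] //; exact: leq_b1.
Qed.

(** Each of the [n - d] common out-neighbours has [n] out-neighbours, of which at most [2 * d] lie
    in the symmetric difference; arcs among the common ones number at most [(n - d) ^ 2 / 2]. The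
    remaining arcs go to [outside]. *)
Lemma card_switchings D x y (d : nat) : D \in at_distance x y d ->
  (n - d) * (n - 3 * d) <=
  2 * #|[set p : V * V | (p.1 \in common D x y) && (p.2 \in out_nbrs D p.1 :&: outside D x y)]|.
Proof.
rewrite inE => /and3P[tD eD /eqP Dd].
rewrite (sum_card _ (fun c => out_nbrs D c :&: outside D x y)).
have dd := card_setD_out x y tD eD; rewrite Dd in dd.
move: eD; rewrite (eulerian_out Vn tD) => /forallP eD.
set C := common D x y.
have Cn : #|C| + d = n by rewrite -Dd cardsID; exact/eqP.
have out_le c : n <= #|out_nbrs D c :&: C| + #|out_nbrs D c :&: outside D x y| + 2 * d.
  rewrite -(eqP (eD c)) -(cardsID C (out_nbrs D c)) -addnA leq_add2l.
  rewrite -(cardsID (outside D x y) (_ :\: _)) leq_add //.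
    by apply: subset_leq_card; apply/subsetP => u; rewrite !inE => /andP[/andP[_ ->] ->].
  rewrite mul2n -addnn -{1}dd -Dd -cardsUI; apply: leq_trans (leq_addr _ _).
  apply: subset_leq_card; apply/subsetP => u; rewrite !inE.
  by case: ((x, u) \in D); case: ((y, u) \in D); rewrite ?andbF.
have : \sum_(c in C) n <= \sum_(c in C)
    (#|out_nbrs D c :&: C| + #|out_nbrs D c :&: outside D x y| + 2 * d).
  by apply: leq_sum => c _; exact: out_le.
rewrite sum_nat_const big_split /= sum_nat_const big_split /=.
have := card_arcs_inside C tD.
have -> : n - d = #|C| by lia.
have -> : n - 3 * d = #|C| - 2 * d by lia.
rewrite -Cn mulnBr; move: (\sum_(i in C) _) (\sum_(i in C) _) => a b.
by rewrite -mulnn; nia.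
Qed.

(** Double counting: a reversal is undone by the same toggle, so it is determined by its result and
    [(c, j)], which leaves at most [d.+1 ^ 2] choices per result. *)
Lemma switching x y (d : nat) : x != y ->
  #|at_distance x y d| * ((n - d) * (n - 3 * d)) <=
  2 * d.+1 ^ 2 * #|at_distance x y d.+1|.
Proof.
move=> xy; pose F D := [set p : V * V | (p.1 \in common D x y) && (p.2 \in out_nbrs D p.1 :&: outside D x y)].
pose G D := finset.setX (out_nbrs D y :\: out_nbrs D x) (out_nbrs D x :\: out_nbrs D y).
pose P := [set p : {set V * V} * (V * V) | (p.1 \in at_distance x y d) && (p.2 \in F p.1)].
pose Q := [set p : {set V * V} * (V * V) | (p.1 \in at_distance x y d.+1) && (p.2 \in G p.1)].
have cP : #|at_distance x y d| * ((n - d) * (n - 3 * d)) <= 2 * #|P|.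
  rewrite sum_card -sum_nat_const big_distrr /=; apply: leq_sum => D; exact: card_switchings.
have cQ : #|Q| = #|at_distance x y d.+1| * d.+1 ^ 2.
  rewrite sum_card -sum_nat_const; apply: eq_bigr => D; rewrite inE => /and3P[tD eD /eqP Dd].
  by rewrite cardsX card_setD_out // Dd mulnn.
apply: leq_trans cP _; rewrite -mulnA leq_mul2l /= [leqRHS]mulnC -cQ.
pose h (p : {set V * V} * (V * V)) := (toggle [set x; p.2.1; p.2.2] p.1, p.2).
have hI : injective h.
  move=> [D1 p1] [D2 p2] [/[swap] <-] /(congr1 (toggle [set x; p1.1; p1.2])) /=.
  by rewrite !toggleK => ->.
rewrite -(card_imset P hI); apply: subset_leq_card; apply/subsetP => _ /imsetP[[D [c j]] hp ->].
rewrite !inE /= negb_or in hp; case/andP: hp => /and3P[tD eD /eqP Dd].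
case/andP=> /andP[xc yc] /and3P[cj xj yj].
have neq a b : (a, b) \in D -> a != b.
  by move=> ab; apply: contraTneq ab => ->; exact: tournament_irr.
have jx : (j, x) \in D.
  rewrite tournamentN //; apply: contraTneq cj => ->; exact: tournament_asym.
have cx : c != x by rewrite eq_sym; exact: neq.
have cy : c != y by rewrite eq_sym; exact: neq.
have jy : j != y by apply: contraTneq cj => ->; exact: tournament_asym.
(* Since [y] is off the triangle, only the out-neighbourhood of [x] changes in the distance: it
   trades [c] for [j]. *)
have yA : y \notin [set x; c; j].
  by rewrite !inE !negb_or eq_sym xy eq_sym cy eq_sym jy.
pose D' := toggle [set x; c; j] D.
have Dx : out_nbrs D' x = j |: (out_nbrs D x :\ c) by exact: out_toggle.
have Dy : out_nbrs D' y = out_nbrs D y by exact: out_toggleN.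
have card' : #|out_nbrs D' x :\: out_nbrs D' y| = d.+1.
  rewrite Dx Dy -Dd -[RHS](_ : #|j |: (out_nbrs D x :\: out_nbrs D y)| = _); last first.
    by rewrite cardsU1 !inE (negPf xj) andbF.
  apply: eq_card => u; rewrite !inE; have [->|uj] := eqVneq u j; first by rewrite yj.
  by have [->|] := eqVneq u c; rewrite ?yc.
have tD' : tournament D' by exact: toggle_tournament.
have eD' : eulerian D' by exact: (toggle_eulerian Vn).
suff : (c, j) \in G D' by rewrite [_ \in Q]inE [_ \in at_distance _ _ _]inE -/D' /= tD' eD' card' eqxx.
rewrite /G Dx Dy !inE /= !eqxx.
by rewrite (negPf (neq _ _ cj)) yc yj.
Qed.

End Codegree.
End Switching.

(** * The payoff matrix of an Eulerian tournament, and near twins *)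

Section Eulerian.
Variable (n : nat).
Local Notation m := (2 * n).+1.
Local Notation V := 'I_m.
Implicit Types (D : {set V * V}) (x y u v : V).

Definition gainz D x y : int := ((x, y) \in D)%:R - ((y, x) \in D)%:R.

Lemma gainzE (R : realType) D x y : tournament D -> gain R D x y = (gainz D x y)%:~R.
Proof.
move=> tD; rewrite /gain /gainz !inE; have := @tournament_asym _ D x y tD.
case: ((x, y) \in D) => [/(_ isT) /negPf ->|_]; first by rewrite subr0.
by case: ((y, x) \in D); rewrite ?subr0 ?sub0r.
Qed.

(* Modulo 2, the payoff matrix of a tournament is the all-ones matrix minus the
   identity; deleting a row and the corresponding column leaves an even order,
   for which this matrix is invertible. *)
Lemma payoff_kernel (R : realType) D (p : V -> R) v : tournament D -> p v = 0 ->
  (forall x, payoff D p x = 0) -> forall y, p y = 0.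
Proof.
move=> tD pv pay.
(* Column [v] is replaced by the condition of vanishing at [v], which keeps the matrix square;
   integer entries allow reduction modulo 2. *)
pose M : 'M[int]_m := \matrix_(y, x) if x == v then (y == v)%:R else gainz D x y.
have detM : \det M != 0.
  apply/negP => /eqP M0.
  have : \det (map_mx (intr : int -> 'F_2) M) == 0 by rewrite det_map_mx M0.
  case/det0P => u u0 uM; move/negP: u0; apply; apply/eqP/rowP => x.
  have col z : \sum_y u 0 y * (M y z)%:~R = 0.
    by have /rowP /(_ z) := uM; rewrite !mxE => {2}<-; apply: eq_bigr => y _; rewrite !mxE.
  have uv : u 0 v = 0.
    have := col v; rewrite (bigD1 v) //= !mxE !eqxx mulr1 big1 ?addr0 //.
    by move=> y /negPf yv; rewrite !mxE eqxx yv mulr0.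
  set s := \sum_y u 0 y.
  have us z : z != v -> u 0 z = s.
    move=> zv; have := col z; rewrite (bigD1 z) //= !mxE (negPf zv) /gainz subrr mulr0 add0r.
    move=> h; rewrite /s (bigD1 z) //= -[LHS]addr0; congr (_ + _); rewrite -[LHS]h.
    apply: eq_bigr => y yz; rewrite !mxE (negPf zv) /gainz (tournamentN tD yz).
    by case: ((z, y) \in D) => /=; rewrite -[RHS]mulr1; congr (_ * _); apply/val_inj.
  (* The [2 * n] coordinates other than [v] all equal [s], and their number is even. *)
  have s0 : s = 0.
    rewrite {1}/s (bigD1 v) //= uv add0r (eq_bigr (fun=> s)) //.
    have s2 : s *+ 2 = 0.
      by rewrite -mulr_natr (_ : 2%:R = 0 :> 'F_2) ?mulr0 //; apply/val_inj.
    by rewrite sumr_const cardC1 card_ord /= mulrnA s2 mul0rn.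
  by rewrite mxE; have [->|/us ->] := eqVneq x v.
have : ~~ (\det (map_mx (intr : int -> R) M) == 0) by rewrite det_map_mx intr_eq0.
move=> /det0P kerM y; pose w : 'rV[R]_m := \row_z p z.
have [w0|w0] := eqVneq w 0; first by have /rowP /(_ y) := w0; rewrite !mxE.
case: kerM; exists w => //; apply/rowP => x; rewrite !mxE.
have [->|xv] := eqVneq x v.
  by apply: big1 => z _; rewrite !mxE eqxx; case: eqP => [->|_]; rewrite ?pv ?mul0r ?mulr0.
rewrite -[RHS](pay x); apply: eq_bigr => z _.
by rewrite !mxE (negPf xv) gainzE.
Qed.

(** Each column of the payoff matrix sums to in-degree minus out-degree. *)
Lemma sum_payoff (R : realType) D (p : V -> R) : tournament D -> eulerian D ->
  \sum_x payoff D p x = 0.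
Proof.
move=> tD /forallP eD; rewrite exchange_big /=; apply: big1 => y _.
rewrite -mulr_sumr; under eq_bigr => x _ do rewrite gainzE // rmorphB /= !rmorph_nat.
rewrite sumrB -!natr_sum; have := eD y; rewrite -!sum1_card => /eqP h.
rewrite (_ : (\sum_i _)%N = (\sum_(i in in_nbrs D y) 1)%N); last first.
  by rewrite [RHS]big_mkcond /=; apply: eq_bigr => x _; rewrite inE; case: (_ \in D).
rewrite -h (_ : (\sum_(i in out_nbrs D y) 1)%N = (\sum_i ((y, i) \in D))%N) ?subrr ?mulr0 //.
by rewrite big_mkcond /=; apply: eq_bigr => x _; rewrite inE; case: (_ \in D).
Qed.

Lemma out_nbrs_neq D x y : tournament D -> eulerian D -> x != y ->
  #|out_nbrs D x :\: out_nbrs D y| != 0%N.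
Proof.
move=> tD eD xy; apply/negP; rewrite cards_eq0 setD_eq0 => sxy.
have exy : out_nbrs D x = out_nbrs D y.
  apply/eqP; rewrite eqEcard sxy; move: eD; rewrite (eulerian_out (card_ord _) tD).
  by move=> /forallP eD; rewrite (eqP (eD x)) (eqP (eD y)) leqnn.
have h u : ((x, u) \in D) = ((y, u) \in D).
  by have /setP /(_ u) := exy; rewrite !inE.
by have := tournamentN tD xy; rewrite h -(h x) !(negPf (tournament_irr _ tD)).
Qed.

(* If no two out-neighbourhoods are that close, then for every [x] a vector
   concentrated on the out-neighbours of [x] other than [v] makes [x] Norman's
   best response. *)
Lemma oblivious_near_twins (R : realType) D : (1 <= n)%N ->
  tournament D -> eulerian D -> oblivious R D ->
  exists x y, x != y /\ #|out_nbrs D x :\: out_nbrs D y| = 1%N.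
Proof.
move=> n1 tD eD [S [Sopt Sobl]]; apply: contrapT => none.
pose v : V := ord0;
pose r x : restriction V :=
  [ffun u => if u == v then 0 else 1 + 2 * m * (u \in out_nbrs D x)]%N.
have rT x : supp (r x) = [set~ v].
  by apply/setP => u; rewrite !inE ffunE; case: eqP.
have hr x : exists u, u \in supp (r x).
  exists ord_max; rewrite rT !inE; apply/eqP => /(congr1 val) /=; lia.
have rmax x y : payoff D (weight R (r x)) y <= payoff D (weight R (r x)) x.
  have [->//|yx] := eqVneq y x; rewrite eq_sym in yx.
  (* The difference has at least two elements, so one survives the deletion of [v]. *)
  have [u0 [u0x u0y u0v]] : exists u0, [/\ (x, u0) \in D, (y, u0) \notin D & u0 != v].
    have d1 : #|out_nbrs D x :\: out_nbrs D y| != 1%N.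
      by apply/negP => /eqP d1; apply: none; exists x, y.
    have d0 := out_nbrs_neq tD eD yx.
    have : (0 < #|(out_nbrs D x :\: out_nbrs D y) :\ v|)%N.
      by have := cardsD1 v (out_nbrs D x :\: out_nbrs D y); lia.
    by case/card_gt0P => u0; rewrite !inE => /and3P[? ? ?]; exists u0.
  rewrite -subr_ge0 /payoff -sumrB.
  (* A termwise lower bound for the difference: [u0] gains at least [2 * m - 2], and each other
     vertex loses at most 2. This explains the weight [2 * m] in [r]. *)
  have : \sum_(u : V) ((2 * m)%:R * pure R u0 u - 2) = 0 :> R.
    rewrite sumrB -mulr_sumr (proj2 (pure_distribution R u0)) sumr_const card_ord.
    by rewrite mulr1 natrM mulr_natr subrr.
  move=> {1}<-; apply: ler_sum => u _; rewrite -mulrBr /weight ffunE.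
  have gy := gain_le R D y u; have gx := gain_ge R D x u.
  have m0 : 0 <= (2 * m)%:R :> R by [].
  rewrite /pure; have [->|uu0] := eqVneq u u0.
    rewrite (negPf u0v) inE u0x muln1 natrD.
    have -> : gain R D x u0 = 1 by rewrite /gain inE u0x.
    have : gain R D y u0 <= 0.
      by rewrite /gain !inE (negPf u0y); case: ifP => // _; lra.
    by rewrite mulr1; move: ((2 * m)%:R : R) m0 => k; nra.
  case: eqP => _; first by rewrite mul0r mulr0; lra.
  rewrite inE; have [xu|xu] := boolP ((x, u) \in D); last by rewrite mulr0 muln0 addn0 mul1r; lra.
  have -> : gain R D x u = 1 by rewrite /gain inE xu.
  by rewrite muln1 natrD mulr0; move: ((2 * m)%:R : R) m0 => k; nra.
pose p := S (r v).
have [[p0 p1] ps] := (proj1 Sopt) _ (hr v).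
have pr x : S (r x) =1 p by apply: Sobl; rewrite !rT.
have pmax x z : payoff D p z <= payoff D p x.
  have := optimal_oblivious_argmax z Sopt Sobl (hr x) (rmax x).
  by rewrite /payoff; under eq_bigr do rewrite pr; under [leRHS]eq_bigr do rewrite pr.
(* Every [x] is a best response to [p], so the payoffs are all equal, and they sum to 0. *)
have pconst x : payoff D p x = 0.
  have := sum_payoff p tD eD; rewrite (eq_bigr (fun=> payoff D p x)).
    by rewrite sumr_const card_ord => /eqP; rewrite mulrn_eq0 => /eqP.
  by move=> z _; apply/le_anti; rewrite !pmax.
have pv : p v = 0 by apply: ps; rewrite rT !inE eqxx.
have := p1; rewrite big1 => [|y _]; last exact: (payoff_kernel tD pv).
by move/esym/eqP; rewrite oner_eq0.
Qed.

(** * Counting tournaments with near twins *)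

Lemma card_near_twins x y : (12 <= n)%N -> x != y ->
  (#|at_distance x y 1| * n ^ 4 <= 1152 * #|eulerian_tournaments n|)%N.
Proof.
move=> n12 xy.
have h1 := switching (card_ord _) 1 xy; have h2 := switching (card_ord _) 2 xy.
have h3 : (#|at_distance x y 3| <= #|eulerian_tournaments n|)%N.
  by apply: subset_leq_card; apply/subsetP => D; rewrite !inE => /and3P[-> ->].
have [k nk] : exists k, n = (12 + k)%N by exists (n - 12)%N; rewrite subnKC.
have k1 : (n ^ 2 <= 2 * ((n - 1) * (n - 3 * 1)))%N.
  have [-> ->] : (n - 1 = 11 + k /\ n - 3 * 1 = 9 + k)%N by lia.
  by rewrite nk; nia.
have k2 : (n ^ 2 <= 4 * ((n - 2) * (n - 3 * 2)))%N.
  have [-> ->] : (n - 2 = 10 + k /\ n - 3 * 2 = 6 + k)%N by lia.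
  by rewrite nk; nia.
rewrite (_ : n ^ 4 = n ^ 2 * n ^ 2)%N; last by rewrite -expnD.
(* The switching constants [2 * 2 ^ 2] and [2 * 3 ^ 2], times the losses 2 and 4 of [k1] and [k2],
   give 16 and 72, whose product is 1152. *)
have h1' : (#|at_distance x y 1| * n ^ 2 <= 16 * #|at_distance x y 2|)%N.
  by apply: leq_trans (leq_mul (leqnn _) k1) _; rewrite mulnCA; lia.
have h2' : (#|at_distance x y 2| * n ^ 2 <= 72 * #|at_distance x y 3|)%N.
  by apply: leq_trans (leq_mul (leqnn _) k2) _; rewrite mulnCA; lia.
rewrite mulnA (leq_trans (leq_mul h1' (leqnn _))) // -mulnA.
by rewrite (leq_trans (leq_mul (leqnn 16) h2')) //; lia.
Qed.

Lemma card_oblivious (R : realType) : (12 <= n)%N ->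
  (#|[set D in eulerian_tournaments n | `[< oblivious R D >]]| * n ^ 2
   <= 9 * 1152 * #|eulerian_tournaments n|)%N.
Proof.
move=> n12; set O := [set _ in _ | _]; set e := #|eulerian_tournaments n|.
(* Union bound over the ordered pairs of near twins. *)
have le_sum : (#|O| <= \sum_(q : V * V | q.1 != q.2) #|at_distance q.1 q.2 1|)%N.
  rewrite -sum1_card.
  under [leqRHS]eq_bigr do rewrite -sum1_card big_mkcond /=.
  rewrite exchange_big /= big_mkcond /=; apply: leq_sum => D _.
  case: ifP => //; rewrite !inE => /andP[/andP[tD eD] /asboolP oD].
  have [x [y [xy d1]]] := oblivious_near_twins (leq_trans (isT : 1 <= 12)%N n12) tD eD oD.
  by rewrite (bigD1 (x, y)) //= inE tD eD d1 eqxx.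
have : (#|O| * n ^ 4 <= (2 * n).+1 ^ 2 * (1152 * e))%N.
  apply: leq_trans (leq_mul le_sum (leqnn _)) _; rewrite big_distrl /=.
  apply: (@leq_trans (\sum_(q : V * V) 1152 * e)%N).
    rewrite big_mkcond /=; apply: leq_sum => q _; case: ifP => // q12.
    exact: card_near_twins.
  by rewrite sum_nat_const card_prod card_ord mulnn.
have n2 : ((2 * n).+1 ^ 2 <= 9 * n ^ 2)%N by nia.
rewrite (_ : n ^ 4 = n ^ 2 * n ^ 2)%N; last by rewrite -expnD.
have : (0 < n ^ 2)%N by rewrite expn_gt0; lia.
move: n2; move: (n ^ 2)%N ((2 * n).+1 ^ 2)%N #|O| => a b o ba a0.
rewrite mulnA => h; rewrite -(leq_pmul2r a0); apply: leq_trans h _.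
by apply: leq_trans (leq_mul ba (leqnn _)) _; lia.
Qed.

End Eulerian.

Theorem theorem4p4 (R : realType) :
  exists C : R, forall n : nat, (1 <= n)%N ->
    prob_oblivious R n <= C * n%:R ^- 2.
Proof.
exists (9 * 1152)%:R => n n1; rewrite /prob_oblivious.
have e0 := eulerian_tournaments_gt0 n.
rewrite ler_pdivrMr ?ltr0n // mulrAC ler_pdivlMr ?exprn_gt0 ?ltr0n //.
rewrite -natrX -!natrM ler_nat.
have [n12|n12] := leqP 12 n; first exact: card_oblivious.
(* For [n < 12] the constant exceeds [n ^ 2], and a probability is at most 1. *)
rewrite mulnC leq_mul //; first by nia.
by apply: subset_leq_card; apply/subsetP => D; rewrite inE => /andP[].
Qed.
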